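(* Let $H$ be a real Hilbert space, let $L,\mu>0$, and let $\mathcal{A}:H\to H$ be $\mu$-strongly monotone and $L$-Lipschitz continuous. Let $K:H\rightrightarrows H$ be a set-valued mapping such that $K(x)$ is a nonempty, closed and convex subset of $H$ for every $x\in H$, and assume there exists $\lambda\ge 0$ such that $$\|P_{K(x)}(z)-P_{K(y)}(z)\|\le \lambda\|x-y\|\quad\text{for all }x,y,z\in H,\qquad \lambda+\sqrt{1-\frac{\mu^2}{L^2}}<1 .$$ Let $\gamma\ge 0$ satisfy $$\left|\gamma-\frac{\mu}{L^2}\right|<\frac{\sqrt{\mu^2-L^2\lambda(2-\lambda)}}{L^2}.$$ Let $0<a\le b<1$, let $(\theta_k)_{k\ge -1}$ be real numbers with $a\le\theta_k\le b$ for all $k$, let $z_{-1}=z_0\in H$ be arbitrary, and let the sequences $\{x_k\}_{k\ge 0}$ and $\{z_k\}_{k\ge 0}$ be generated, for $k=0,1,2,\dots$, by $$\begin{cases} y_{k-1}=z_k+\Big(\dfrac{1-2\theta_{k-1}}{\theta_{k-1}}\Big)(z_k-z_{k-1}),\\[1mm] x_k=P_{K(y_{k-1})}\big(y_{k-1}-\gamma\mathcal{A}(y_{k-1})\big),\\[1mm] z_{k+1}=(1-\theta_k)z_k+\theta_k x_k.\end{cases}$$ Then both $\{x_k\}$ and $\{z_k\}$ converge linearly to the unique solution $x_*\in K(x_* )$ of the quasi-variational inequality $$x_*\in K(x_* ),\qquad \langle\mathcal{A}(x_* ),x-x_*\rangle\ge 0\quad\text{for all }x\in K(x_* ).$$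
   Context: $\langle\cdot,\cdot\rangle$ and $\|\cdot\|$ denote the inner product and induced norm of $H$. The operator $\mathcal{A}$ is $L$-Lipschitz continuous if $\|\mathcal{A}(x)-\mathcal{A}(y)\|\le L\|x-y\|$ for all $x,y\in H$, and $\mu$-strongly monotone if $\langle\mathcal{A}(x)-\mathcal{A}(y),x-y\rangle\ge\mu\|x-y\|^2$ for all $x,y\in H$. For a nonempty closed convex set $C\subset H$, $P_C(x)$ denotes the unique nearest point of $C$ to $x$ (metric projection). Under the stated hypotheses on $\mathcal{A}$ and $K(\cdot)$, it is known that the quasi-variational inequality has exactly one solution. A sequence $\{u_k\}$ in $H$ converges linearly to $x_*$ if there exist a constant $M\ge 0$ and $\varrho\in(0,1)$ such that $\|u_k-x_*\|\le M\varrho^{k}$ for all $k\ge 0$. *)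

(* Defs.v *)
From HB Require Import structures.
From mathcomp Require Import all_boot all_order all_algebra.
From mathcomp Require Import all_classical all_reals all_analysis.

Set Implicit Arguments.
Unset Strict Implicit.
Unset Printing Implicit Defensive.

Import Order.TTheory GRing.Theory Num.Theory.
Import numFieldNormedType.Exports.

Local Open Scope classical_set_scope.
Local Open Scope ring_scope.

(* A real Hilbert space is a [completeNormedModType] [H] over a [realType],
   together with an inner product [dot : {dot H for idfun}] (a symmetric
   positive definite bilinear form) such that [induces_norm dot]. *)
Definition induces_norm (R : realType) (H : normedModType R)
    (dot : {dot H for idfun}) : Prop :=
  forall x : H, `|x| = Num.sqrt (dot x x).

Definition strongly_monotone (R : realType) (H : normedModType R)
    (dot : {dot H for idfun}) (mu : R) (A : H -> H) : Prop :=
  forall x y : H, mu * `|x - y| ^+ 2 <= dot (A x - A y) (x - y).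

(* Nearest point of [C] to [z]. When [H] is a Hilbert space and [C] is nonempty,
   closed and convex, it exists and is unique; the default value [z] is only
   returned when no nearest point exists. *)
Definition metric_projection (R : realType) (H : normedModType R)
    (C : set H) (z : H) : H :=
  xget z [set p | C p /\ forall q, C q -> `|z - p| <= `|z - q|].

Definition qvi_solution (R : realType) (H : normedModType R)
    (dot : {dot H for idfun}) (A : H -> H) (K : H -> set H) (xs : H) : Prop :=
  K xs xs /\ forall x, K xs x -> 0 <= dot (A xs) (x - xs).

Definition converges_linearly (R : realType) (H : normedModType R)
    (u : nat -> H) (l : H) : Prop :=
  exists M rho : R, [/\ 0 <= M, 0 < rho < 1 &
    forall k : nat, `|u k - l| <= M * rho ^+ k].

(* Main.v *)
(* The map [T u = P_{K(u)} (u - gamma A u)] is a contraction with ratio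
   [q = lambda + sqrt (1 - 2 gamma mu + gamma^2 L^2) < 1], and its fixed points
   are exactly the solutions of the quasi-variational inequality, so Banach's
   theorem gives the unique solution [xs]. The extrapolation is designed so that
   [y_k = theta_k z_k + (1 - theta_k) x_k]; hence, with [e_k = |z_k - xs|] and
   [f_k = |x_k - xs|],
     [e_{k+1} <= (1 - theta_k) e_k + theta_k f_k] and
     [f_{k+1} <= q (theta_k e_k + (1 - theta_k) f_k)],
   and [e_k + f_k] decays geometrically because [theta_k] stays away from 0
   and 1. *)
Require Import Defs.
From HB Require Import structures.
From mathcomp Require Import all_boot all_order all_algebra.
From mathcomp Require Import all_classical all_reals all_analysis.
From mathcomp Require Import ring lra.

Set Implicit Arguments.
Unset Strict Implicit.
Unset Printing Implicit Defensive.

Import Order.TTheory GRing.Theory Num.Theory.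
Import numFieldNormedType.Exports.

Local Open Scope classical_set_scope.
Local Open Scope ring_scope.

(** * Inner product identities and the Cauchy-Schwarz inequality *)

Section InnerProduct.
Variables (R : realType) (H : normedModType R) (dot : {dot H for idfun}).
Implicit Types u v w : H.

Lemma dotC u v : dot u v = dot v u.
Proof. by rewrite (hermC dot) expr0 mul1r. Qed.

Lemma dotDr u v w : dot u (v + w) = dot u v + dot u w.
Proof. exact: linearDr. Qed.

Lemma dotDl u v w : dot (u + v) w = dot u w + dot v w.
Proof. by rewrite dotC dotDr !(dotC w). Qed.

Lemma dotNr u v : dot u (- v) = - dot u v.
Proof. exact: linearNr. Qed.

Lemma dotNl u v : dot (- u) v = - dot u v.
Proof. by rewrite dotC dotNr dotC. Qed.

Lemma dotZr k u v : dot u (k *: v) = k * dot u v.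
Proof. by rewrite linearZr_LR. Qed.

Lemma dotZl k u v : dot (k *: u) v = k * dot u v.
Proof. by rewrite dotC dotZr dotC. Qed.

Definition dotE := (dotDl, dotDr, dotNl, dotNr, dotZl, dotZr).

Hypothesis hdot : induces_norm dot.

Lemma sqr_norm_dot u : `|u| ^+ 2 = dot u u.
Proof.
rewrite hdot sqr_sqrtr//; have [->|u0] := eqVneq u 0.
  by rewrite linear0r.
by rewrite ltW// neq0_dnorm_gt0.
Qed.

(** The square expands to [2 * |u| * |v| * (|u| * |v| - dot u v)]; the zero vectors are set aside so
    that [|u| * |v|] can be cancelled. *)
Lemma cauchy_schwarz u v : dot u v <= `|u| * `|v|.
Proof.
have := sqr_ge0 `| `|v| *: u - `|u| *: v|.
rewrite sqr_norm_dot !dotE -!sqr_norm_dot (dotC v u).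
have [->|u0] := eqVneq u 0; first by rewrite linear0l normr0 mul0r.
have [->|v0] := eqVneq v 0; first by rewrite linear0r normr0 mulr0.
have uv : 0 < `|u| * `|v| by rewrite mulr_gt0 ?normr_gt0.
by move=> h; rewrite -(ler_pM2l uv); nra.
Qed.

Lemma apollonius z u v :
  `|u - v| ^+ 2 = 2 * `|z - u| ^+ 2 + 2 * `|z - v| ^+ 2
    - 4 * `|z - (2^-1 *: u + 2^-1 *: v)| ^+ 2.
Proof.
by rewrite !sqr_norm_dot !dotE (dotC v u) (dotC u z) (dotC v z); field.
Qed.

Lemma sqr_norm_sub_segment z u v (t : R) :
  `|z - (t *: u + (1 - t) *: v)| ^+ 2 =
  `|z - v| ^+ 2 - 2 * t * dot (z - v) (u - v) + t ^+ 2 * `|u - v| ^+ 2.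
Proof.
by rewrite !sqr_norm_dot !dotE (dotC v u) (dotC u z) (dotC v z); ring.
Qed.

Lemma sqr_normB u v : `|u - v| ^+ 2 = `|u| ^+ 2 - 2 * dot u v + `|v| ^+ 2.
Proof. by rewrite !sqr_norm_dot !dotE (dotC v u); ring. Qed.

(** When [u] and [v] are the projections of [z] and [w], the last two terms are nonpositive. This
    gives nonexpansiveness, and uniqueness when [z = w]. *)
Lemma sqr_norm_obtuse_sum z w u v :
  `|u - v| ^+ 2 = dot (z - w) (u - v) + dot (z - u) (v - u)
    + dot (w - v) (u - v).
Proof. by rewrite sqr_norm_dot !dotE (dotC v u); ring. Qed.

End InnerProduct.

(** * Metric projection onto a nonempty closed convex set *)

Lemma convex_set_combination (R : realType) (H : normedModType R) (C : set H)
    (t : R) (u v : H) :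
  convex_set (C : set (convex_lmodType H)) -> 0 <= t <= 1 -> C u -> C v ->
  C (t *: u + (1 - t) *: v).
Proof.
move=> cC t01 /mem_set Cu /mem_set Cv; case/andP: t01 => t0 t1.
by have := cC u v (Itv01 t0 t1) Cu Cv => /set_mem.
Qed.

Section MetricProjection.
Variables (R : realType) (H : completeNormedModType R) (dot : {dot H for idfun}).
Hypothesis hdot : induces_norm dot.
Variable C : set H.
Hypotheses (C0 : C !=set0) (Cclosed : closed C)
  (Cconvex : convex_set (C : set (convex_lmodType H))).
Implicit Types p q z w : H.

(** A minimizing sequence for the squared distance is Cauchy by convexity of [C]; its limit stays in
    [C] by closedness and attains the infimum. *)
Lemma nearest_point_exists z :
  exists p, C p /\ forall q, C q -> `|z - p| <= `|z - q|.
Proof.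
pose E : set R := [set `|z - q| ^+ 2 | q in C].
have Elb : has_lbound E by exists 0 => _ [q _ <-]; exact: sqr_ge0.
have Einf : has_inf E.
  by split => //; case: C0 => q Cq; exists (`|z - q| ^+ 2), q.
have infE q : C q -> inf E <= `|z - q| ^+ 2.
  by move=> Cq; apply: ge_inf => //; exists q.
have /choice[u_ u_E] : forall n : nat, exists q,
    C q /\ `|z - q| ^+ 2 < inf E + n.+1%:R^-1.
  move=> n; have n0 : 0 < n.+1%:R^-1 :> R by rewrite invr_gt0.
  by have [_ [q Cq <-] ltq] := inf_adherent n0 Einf; exists q.
have u_C n : C (u_ n) by have [] := u_E n.
(* The midpoint of [u_ n] and [u_ m] lies in [C], so its squared distance to [z] is at least
   [inf E], and the four copies of [inf E] in [apollonius] cancel. *)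
have u_cauchy n m : `|u_ n - u_ m| ^+ 2 <= 2 * n.+1%:R^-1 + 2 * m.+1%:R^-1.
  rewrite (apollonius hdot z).
  have half01 : 0 <= (2^-1 : R) <= 1 by apply/andP; split; lra.
  have := infE _ (convex_set_combination Cconvex half01 (u_C n) (u_C m)).
  rewrite (_ : 1 - 2^-1 = 2^-1); last by field.
  have [_ +] := u_E n; have [_ +] := u_E m.
  move: (n.+1%:R^-1) (m.+1%:R^-1) => r r'; lra.
have u_cvg : cvgn u_.
  apply/cauchy_cvgP; apply/cauchy_ballP => e e0; near_simpl.
  (* With this threshold each of the two terms of [u_cauchy] is below [e ^+ 2 / 2]. *)
  have [N _ NP] : \forall n \near \oo, n.+1%:R^-1 < e ^+ 2 / 4.
    have e4 : 0 < e ^+ 2 / 4 by rewrite divr_gt0// exprn_gt0.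
    exact: (near_infty_natSinv_lt (PosNum e4)).
  exists ([set n | N <= n]%N, [set n | N <= n]%N); first by split; exists N.
  move=> [n m] /= [/NP/= ltn /NP/= ltm]; rewrite -ball_normE /=.
  rewrite -(@ltr_pXn2r _ 2%N) ?nnegrE// ?(ltW e0)//.
  have := u_cauchy n m.
  by move: ltn ltm; move: (n.+1%:R^-1) (m.+1%:R^-1) => r r'; lra.
exists (limn u_); split.
  by apply: closed_cvg u_cvg => //; exact: nearW.
move=> q Cq; rewrite -(@ler_pXn2r _ 2%N) ?nnegrE//; apply: le_trans (infE q Cq).
have dist_cvg : (`|z - u_ n| ^+ 2 : R) @[n --> \oo] --> `|z - limn u_| ^+ 2.
  apply: (@cvg_comp _ _ _ (fun n => `|z - u_ n|) (fun r : R => r ^+ 2)).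
    by apply: cvg_norm; exact: (cvgB (cvg_cst _) u_cvg).
  exact: exprn_continuous.
have inf_cvg : (inf E + n.+1%:R^-1 : R) @[n --> \oo] --> inf E.
  rewrite -[X in _ --> X]addr0; apply: cvgD; first exact: cvg_cst.
  exact: cvg_harmonic.
apply: (ler_cvg_to dist_cvg inf_cvg).
by apply: nearW => n; have [_ /ltW] := u_E n.
Qed.

Lemma metric_projectionP z :
  C (metric_projection C z) /\
  forall q, C q -> `|z - metric_projection C z| <= `|z - q|.
Proof. exact: (xgetPex z (nearest_point_exists z)). Qed.

(* First-order optimality along the segment from [P z] to [q]: if the scalar
   product [d] were positive, the step [t = min(1, d / |q - P z|^2)] would get
   strictly closer to [z]. *)
Lemma metric_projection_obtuse z q : C q ->
  dot (z - metric_projection C z) (q - metric_projection C z) <= 0.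
Proof.
move=> Cq; have [Cp p_min] := metric_projectionP z.
set p := metric_projection C z in Cp p_min *.
have key t : 0 <= t <= 1 ->
    2 * t * dot (z - p) (q - p) <= t ^+ 2 * `|q - p| ^+ 2.
  move=> t01.
  have := p_min _ (convex_set_combination Cconvex t01 Cq Cp).
  move/(lerXn2r 2 (normr_ge0 _) (normr_ge0 _)).
  by rewrite (sqr_norm_sub_segment hdot); lra.
rewrite leNgt; apply/negP => d0; set d := dot _ _ in key d0.
have n0 : 0 <= `|q - p| ^+ 2 by exact: sqr_ge0.
have [dn|nd] := leP d (`|q - p| ^+ 2).
  have n1 : 0 < `|q - p| ^+ 2 by exact: lt_le_trans dn.
  pose t := d / `|q - p| ^+ 2.
  have t0 : 0 < t by rewrite divr_gt0.
  have tE : t * `|q - p| ^+ 2 = d by rewrite divfK// gt_eqF.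
  have /key : 0 <= t <= 1 by rewrite (ltW t0) ler_pdivrMr// mul1r.
  rewrite (expr2 t) -[_ * _ * `|q - p| ^+ 2]mulrA tE.
  by have := mulr_gt0 t0 d0; lra.
have /key : 0 <= (1 : R) <= 1 by rewrite ler01 lexx.
by lra.
Qed.

(** Converse of the obtuse angle property: the inequality at [p], tested against the projection, and
    the one at the projection, tested against [p], add up to a nonpositive squared distance. *)
Lemma eq_metric_projection z p : C p ->
  (forall q, C q -> dot (z - p) (q - p) <= 0) -> metric_projection C z = p.
Proof.
move=> Cp p_obt; have [Cz _] := metric_projectionP z.
have := metric_projection_obtuse z Cp; have := p_obt _ Cz.
set m := metric_projection C z => h1 h2; apply/subr0_eq/normr0_eq0/eqP.
rewrite -sqrf_eq0 eq_le sqr_ge0 andbT (sqr_norm_obtuse_sum hdot z z).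
by rewrite subrr linear0l; lra.
Qed.

Lemma metric_projection_nonexpansive z w :
  `|metric_projection C z - metric_projection C w| <= `|z - w|.
Proof.
have [Cz _] := metric_projectionP z; have [Cw _] := metric_projectionP w.
have := metric_projection_obtuse z Cw; have := metric_projection_obtuse w Cz.
set p := metric_projection C z; set p' := metric_projection C w => h1 h2.
have [->|pp'] := eqVneq p p'; first by rewrite subrr normr0.
have pp'0 : 0 < `|p - p'| by rewrite normr_gt0 subr_eq0.
rewrite -(ler_pM2r pp'0) -expr2; apply: le_trans (cauchy_schwarz hdot _ _).
by rewrite (sqr_norm_obtuse_sum hdot z w); lra.
Qed.

End MetricProjection.

(** * The forward step and the choice of step size *)

Lemma forward_step_lipschitz (R : realType) (H : normedModType R)
    (dot : {dot H for idfun}) (A : H -> H) (mu L gamma : R) (u v : H) :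
  induces_norm dot -> strongly_monotone dot mu A -> L.-lipschitz A ->
  0 <= gamma ->
  `|(u - gamma *: A u) - (v - gamma *: A v)|
    <= Num.sqrt (1 - 2 * gamma * mu + gamma ^+ 2 * L ^+ 2) * `|u - v|.
Proof.
move=> hdot Amono Alip gamma0.
have -> : (u - gamma *: A u) - (v - gamma *: A v) =
    (u - v) - gamma *: (A u - A v).
  by rewrite scalerBr !opprB addrACA [RHS]addrACA; congr (_ + _); rewrite addrC.
have Alip2 : `|A u - A v| ^+ 2 <= L ^+ 2 * `|u - v| ^+ 2.
  have le_uv : `|A u - A v| <= L * `|u - v| by exact: (Alip (u, v)).
  rewrite -exprMn; apply: lerXn2r (le_uv); rewrite nnegrE//.
  exact: le_trans le_uv.
rewrite -[X in X <= _]ger0_norm// -sqrtr_sqr -[X in _ * X]ger0_norm//.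
(* The square is moved to the front because [sqrtrM] asks for the sign of its first factor only; the
   sign of the other radicand is not established here. *)
rewrite -[X in _ * X]sqrtr_sqr mulrC -sqrtrM ?sqr_ge0// ler_wsqrtr//.
rewrite (sqr_normB hdot) dotZr normrZ exprMn (ger0_norm gamma0) (dotC dot).
have := ler_wpM2l gamma0 (Amono u v).
by have := ler_wpM2l (sqr_ge0 gamma) Alip2; lra.
Qed.

(** Squaring the step-size bound and dividing by [L ^+ 2] turns it into [1 - 2 * gamma * mu + gamma
    ^+ 2 * L ^+ 2 < (1 - lambda) ^+ 2]. At [gamma = 0] this would read [1 < (1 - lambda) ^+ 2],
    which is impossible. *)
Lemma step_size_contraction (R : realType) (L mu lambda gamma : R) :
  0 < L -> 0 <= lambda -> lambda < 1 -> 0 <= gamma ->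
  `|gamma - mu / L ^+ 2|
    < Num.sqrt (mu ^+ 2 - L ^+ 2 * lambda * (2 - lambda)) / L ^+ 2 ->
  0 < gamma /\
  lambda + Num.sqrt (1 - 2 * gamma * mu + gamma ^+ 2 * L ^+ 2) < 1.
Proof.
move=> L0 lambda0 lambda1 gamma0; set s := mu ^+ 2 - _ => hgamma.
have L20 : 0 < L ^+ 2 by rewrite exprn_gt0.
have {hgamma} hs : `|gamma * L ^+ 2 - mu| < Num.sqrt s.
  move: hgamma; rewrite ltr_pdivlMr// -[X in _ * X](gtr0_norm L20) -normrM.
  by rewrite mulrBl divfK// gt_eqF.
(* [Num.sqrt] vanishes on negative reals, so a positive root forces a positive radicand. *)
have s0 : 0 < s by rewrite -sqrtr_gt0; exact: le_lt_trans hs.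
have hs2 : (gamma * L ^+ 2 - mu) ^+ 2 < s.
  by rewrite -(sqr_sqrtr (ltW s0)) -real_normK ?num_real// ltrXn2r.
have hq : 1 - 2 * gamma * mu + gamma ^+ 2 * L ^+ 2 < (1 - lambda) ^+ 2.
  by rewrite -(ltr_pM2l L20); move: hs2; rewrite /s; lra.
split; last first.
  rewrite -ltrBrDl -[X in _ < X]ger0_norm ?subr_ge0 ?ltW// -sqrtr_sqr.
  by rewrite ltr_sqrt// exprn_gt0// subr_gt0.
rewrite lt_neqAle gamma0 andbT; apply/eqP => g0.
by move: hq; rewrite -g0; nra.
Qed.

(** * The quasi-variational inequality as a fixed-point problem *)

Section QuasiVariationalInequality.
Variables (R : realType) (H : completeNormedModType R) (dot : {dot H for idfun}).
Hypothesis hdot : induces_norm dot.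
Variables (A : H -> H) (K : H -> set H) (gamma : R).
Hypothesis hK : forall x : H,
  [/\ K x !=set0, closed (K x) & convex_set (K x : set (convex_lmodType H))].

Definition projection_step (u : H) : H :=
  metric_projection (K u) (u - gamma *: A u).

(** The obtuse angle condition for [xs] as projection of [xs - gamma *: A xs] is the variational
    inequality multiplied by [- gamma]; positivity of [gamma] allows dividing it out. *)
Lemma qvi_solutionP xs : 0 < gamma ->
  qvi_solution dot A K xs <-> projection_step xs = xs.
Proof.
move=> gamma0; have [K0 Kcl Kcv] := hK xs.
have dotE' w : dot (xs - gamma *: A xs - xs) w = - (gamma * dot (A xs) w).
  by rewrite [xs - _]addrC addrK dotNl dotZl.
split=> [[Kxs xs_vi]|fix_xs].
  apply: (eq_metric_projection hdot) => // q Kq.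
  by rewrite dotE' oppr_le0 mulr_ge0 ?xs_vi// ltW.
have [Kxs _] := metric_projectionP hdot K0 Kcl Kcv (xs - gamma *: A xs).
rewrite -/(projection_step xs) fix_xs in Kxs; split=> // q Kq.
have := metric_projection_obtuse hdot K0 Kcl Kcv (xs - gamma *: A xs) Kq.
rewrite -/(projection_step xs) fix_xs dotE' oppr_le0.
by rewrite pmulr_rge0.
Qed.

(** Passing through the projection of [u - gamma *: A u] onto [K v] separates the change of set,
    which costs [lambda], from the change of point, which costs the forward-step factor. *)
Lemma projection_step_lipschitz (mu L lambda : R) u v :
  strongly_monotone dot mu A -> L.-lipschitz A -> 0 <= gamma ->
  (forall x y z, `|metric_projection (K x) z - metric_projection (K y) z|
     <= lambda * `|x - y|) ->
  `|projection_step u - projection_step v| <=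
  (lambda + Num.sqrt (1 - 2 * gamma * mu + gamma ^+ 2 * L ^+ 2)) * `|u - v|.
Proof.
move=> Amono Alip gamma0 Klip; have [K0 Kcl Kcv] := hK v.
rewrite mulrDl (le_trans (ler_distD
  (metric_projection (K v) (u - gamma *: A u)) _ _))// lerD//; first exact: Klip.
apply: le_trans (forward_step_lipschitz u v hdot Amono Alip gamma0).
exact: (metric_projection_nonexpansive hdot).
Qed.

End QuasiVariationalInequality.

(** * Banach fixed point and decay of coupled recurrences *)

Lemma contraction_fixpoint_exists (R : realType) (H : completeNormedModType R)
    (f : H -> H) (q : R) :
  0 <= q -> q < 1 -> (forall u v, `|f u - f v| <= q * `|u - v|) ->
  exists p, f p = p.
Proof.
move=> q0 q1 flip.
have [|||p _ pE] := @banach_fixed_point R H setT (totalfun f).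
- by exists (NngNum q0); split=> // -[u v] _; exact: flip.
- exact: closedT.
- by exists 0.
- by exists p; rewrite {2}pE.
Qed.

(* Adding the two recurrences gives [e (n+1) + f (n+1)] at most
   [(1 - (1 - q) theta) e n + (1 - (1 - q) (1 - theta)) f n]. *)
Lemma coupled_linear_decay (R : realType) (q a b : R) (theta e f : nat -> R) :
  0 <= q -> q < 1 -> 0 < a -> b < 1 ->
  (forall n, a <= theta n <= b) ->
  (forall n, 0 <= e n) -> (forall n, 0 <= f n) ->
  (forall n, e n.+1 <= (1 - theta n) * e n + theta n * f n) ->
  (forall n, f n.+1 <= q * (theta n * e n + (1 - theta n) * f n)) ->
  exists2 rho, 0 < rho < 1 & forall n, e n + f n <= (e 0 + f 0) * rho ^+ n.
Proof.
move=> q0 q1 a0 b1 theta_ab e0 f0 eS fS.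
(* This instance yields [a <= b < 1], which makes [1 - (1 - q) * a], and hence [rho], positive. *)
have [a_theta0 theta0_b] := andP (theta_ab 0).
(* The coefficient of [e n] is largest at [theta n = a], that of [f n] at [theta n = b]. *)
pose rho := Num.max (1 - (1 - q) * a) (1 - (1 - q) * (1 - b)).
have rho_a : 1 - (1 - q) * a <= rho by rewrite le_max lexx.
have rho_b : 1 - (1 - q) * (1 - b) <= rho by rewrite le_max lexx orbT.
have rho0 : 0 < rho by apply: lt_le_trans rho_a; nra.
exists rho; first by rewrite rho0/= gt_max; apply/andP; split; nra.
elim=> [|n IH]; first by rewrite expr0 mulr1.
rewrite exprSr mulrA; apply: le_trans (ler_wpM2r (ltW rho0) IH).
have [a_theta theta_b] := andP (theta_ab n).
have he : (1 - (1 - q) * theta n) * e n <= rho * e n.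
  by rewrite ler_wpM2r//; apply: le_trans rho_a; nra.
have hf : (1 - (1 - q) * (1 - theta n)) * f n <= rho * f n.
  by rewrite ler_wpM2r//; apply: le_trans rho_b; nra.
by have := eS n; have := fS n; lra.
Qed.

(** * The extrapolated iteration and its convergence *)

(** With [d = v - u], the point [w] is [u + t *: d] and the extrapolation adds [(1 - 2 * t) *: d],
    for a total of [u + (1 - t) *: d]. *)
Lemma extrapolation_swaps_weights (R : realType) (V : lmodType R) (t : R)
    (u v : V) : t != 0 ->
  let w := (1 - t) *: u + t *: v in
  w + ((1 - 2 * t) / t) *: (w - u) = t *: u + (1 - t) *: v.
Proof.
move=> t0 /=; rewrite -[v](subrK u); move: (v - u) => d.
have -> : (1 - t) *: u + t *: (d + u) = u + t *: d.
  by rewrite scalerDr addrCA -scalerDl subrK scale1r addrC.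
rewrite [u + _ - u]addrC addKr scalerA divfK// -addrA -scalerDl.
have -> : t *: u + (1 - t) *: (d + u) = u + (1 - t) *: d.
  by rewrite scalerDr addrCA -scalerDl [t + _]addrC subrK scale1r addrC.
by congr (_ + _ *: _); ring.
Qed.

Theorem theorem3p3 (R : realType) (H : completeNormedModType R)
    (dot : {dot H for idfun}) (hdot : induces_norm dot)
    (L mu : R) (hL : 0 < L) (hmu : 0 < mu)
    (A : H -> H)
    (hAmono : strongly_monotone dot mu A)
    (hAlip : L.-lipschitz A)
    (K : H -> set H)
    (hK : forall x : H,
      [/\ K x !=set0, closed (K x) &
          convex_set (K x : set (convex_lmodType H))])
    (lambda : R) (hlambda : 0 <= lambda)
    (hKlip : forall x y z : H,
      `|metric_projection (K x) z - metric_projection (K y) z|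
        <= lambda * `|x - y|)
    (hlambda1 : lambda + Num.sqrt (1 - mu ^+ 2 / L ^+ 2) < 1)
    (gamma : R) (hgamma : 0 <= gamma)
    (hgamma1 : `|gamma - mu / L ^+ 2|
      < Num.sqrt (mu ^+ 2 - L ^+ 2 * lambda * (2 - lambda)) / L ^+ 2)
    (a b : R) (ha : 0 < a) (hab : a <= b) (hb : b < 1)
    (theta : int -> R)
    (htheta : forall k : int, -1 <= k -> a <= theta k <= b)
    (x : nat -> H) (y z : int -> H)
    (hz0 : z (-1) = z 0)
    (hy : forall k : nat,
      y (k%:Z - 1) = z k%:Z +
        ((1 - 2 * theta (k%:Z - 1)) / theta (k%:Z - 1))
          *: (z k%:Z - z (k%:Z - 1)))
    (hx : forall k : nat,
      x k = metric_projection (K (y (k%:Z - 1)))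
              (y (k%:Z - 1) - gamma *: A (y (k%:Z - 1))))
    (hz : forall k : nat,
      z (k%:Z + 1) = (1 - theta k%:Z) *: z k%:Z + theta k%:Z *: x k) :
  exists xs : H,
    [/\ qvi_solution dot A K xs,
        forall xs' : H, qvi_solution dot A K xs' -> xs' = xs,
        converges_linearly x xs &
        converges_linearly (fun k : nat => z k%:Z) xs].
Proof.
have lambda1 : lambda < 1.
  by apply: le_lt_trans hlambda1; rewrite lerDl sqrtr_ge0.
have [gamma0 q1] := step_size_contraction hL hlambda lambda1 hgamma hgamma1.
set q := lambda + _ in q1.
have q0 : 0 <= q by rewrite addr_ge0 ?sqrtr_ge0.
pose T := projection_step A K gamma.
have Tlip u v : `|T u - T v| <= q * `|u - v|.
  exact: (projection_step_lipschitz hdot hK u v hAmono hAlip hgamma hKlip).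
have [xs Txs] := contraction_fixpoint_exists q0 q1 Tlip.
have theta_ab (n : nat) : a <= theta n%:Z <= b by exact: htheta.
have theta01 (n : nat) : 0 < theta n%:Z < 1.
  have /andP[a_theta theta_b] := theta_ab n.
  by rewrite (lt_le_trans ha)//= (le_lt_trans theta_b).
have zS (n : nat) :
    z n.+1%:Z = (1 - theta n%:Z) *: z n%:Z + theta n%:Z *: x n.
  by rewrite -addn1 PoszD hz.
have yE (n : nat) : y n%:Z = theta n%:Z *: z n%:Z + (1 - theta n%:Z) *: x n.
  have /andP[t0 _] := theta01 n.
  have := hy n.+1; rewrite -addn1 PoszD addrK -PoszD addn1 zS => ->.
  by rewrite extrapolation_swaps_weights ?gt_eqF.
(* The index shift turns [y (k - 1)] into [y n] at [k = n + 1], so the recurrence for the errors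
   starts from [x 0] and [z 0]. *)
have xS (n : nat) : x n.+1 = T (y n%:Z).
  by have := hx n.+1; rewrite -addn1 PoszD addrK addn1.
have comb (t : R) (u v : H) : 0 < t < 1 ->
    `|(1 - t) *: u + t *: v - xs| <= (1 - t) * `|u - xs| + t * `|v - xs|.
  move=> /andP[t0 t1].
  have -> : (1 - t) *: u + t *: v - xs = (1 - t) *: (u - xs) + t *: (v - xs).
    by rewrite !scalerBr addrACA -opprD -scalerDl subrK scale1r.
  apply: le_trans (ler_normD _ _) _.
  by rewrite !normrZ (gtr0_norm t0) gtr0_norm// subr_gt0.
have [|n|rho rho01 decay] := @coupled_linear_decay R q a b (fun n => theta n%:Z)
  (fun n => `|z n%:Z - xs|) (fun n => `|x n - xs|) q0 q1 ha hb theta_ab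
  (fun=> normr_ge0 _) (fun=> normr_ge0 _).
- by move=> n; rewrite zS; exact: comb.
(* Only the [xs] on the left becomes [T xs], so that the contraction bounds the new error by [q]
   times the error of [y n]. *)
- rewrite xS -{1}Txs; apply: le_trans (Tlip _ _) _.
  by rewrite ler_wpM2l// yE [_ *: z _ + _]addrC [leRHS]addrC comb.
exists xs; split.
- by apply/(qvi_solutionP hdot A hK xs gamma0).
- move=> xs' /(qvi_solutionP hdot A hK _ gamma0) Txs'.
  apply/subr0_eq/normr0_eq0/eqP; rewrite eq_le normr_ge0 andbT.
  by have := Tlip xs' xs; rewrite Txs /T Txs'; nra.
(* The decay of the sum of both errors bounds each of them, with the same constant and ratio. *)
- exists (`|z 0 - xs| + `|x 0%N - xs|), rho; split=> //.
  by move=> k; apply: le_trans (decay k); rewrite lerDr.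
- exists (`|z 0 - xs| + `|x 0%N - xs|), rho; split=> //.
  by move=> k; apply: le_trans (decay k); rewrite lerDl.
Qed.
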